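(* Let $n\geq 3$ and let $P\subset\mathbb{R}^n$ be a Platonic polytope generated by a finite Coxeter group $W$ whose Coxeter-Dynkin diagram is a connected line with nodes numbered consecutively $1,\dots,n$, with seed point $\omega_1$ or $\omega_n$ (i.e. the single square of the seed decoration is at an extreme node). For $0\leq d\leq n-1$ let $f_d$ denote a $d$-dimensional face of $P$, and let $G_s(f_d)$ be the subgroup of $W$ which stabilizes $f_d$ pointwise. Then for every $d\in\{1,\dots,n-2\}$ the number $\# f_d(f_{d-1})$ of $d$-dimensional faces $f_d$ of $P$ meeting in (i.e. containing) a given $(d-1)$-dimensional face $f_{d-1}$ is $$\# f_d(f_{d-1})=\frac{|W(G_s(f_{d-1}))|}{|W(G_s(f_d))|},$$ where $|W(G_s(f))|$ denotes the order of the reflection group $G_s(f)$.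
   Context: Finite Coxeter group: a finite reflection group $W$ acting on the real Euclidean space $\mathbb{R}^n$ spanned by linearly independent simple roots $\alpha_1,\dots,\alpha_n$. It is generated by the reflections $r_k x = x-\frac{2\langle \alpha_k,x\rangle}{\langle\alpha_k,\alpha_k\rangle}\alpha_k$, $k=1,\dots,n$. The relevant diagrams are those of types $A_n$, $B_n$, $C_n$ ($n\ge 3$), $F_4$, $H_3$, $H_4$. These diagrams are lines: node $k$ is linked to node $k+1$ for $1\leq k\leq n-1$, and there are no other links. The point $\omega_k$ is the fundamental weight dual to $\alpha_k$: $\frac{2\langle\omega_k,\alpha_j\rangle}{\langle\alpha_j,\alpha_j\rangle}=\delta_{kj}$. The polytope generated by $W$ from a seed point $x_0$ is the convex hull of the orbit $Wx_0$. It is Platonic if, for each $0\leq d\leq n-1$, all of its $d$-dimensional faces lie in one $W$-orbit. This is the case for the seed points $\omega_1$ and $\omega_n$ and the diagrams above. Seed decoration: a node $k$ carries a square if $r_k$ moves the seed point and a lozenge if $r_k$ fixes it. Representative faces and stabilizers: for seed point $\omega_1$, a representative $d$-dimensional face $f_d$ is the convex hull of the orbit of $\omega_1$ under $\langle r_1,\dots,r_d\rangle$, and its pointwise stabilizer is the reflection group $G_s(f_d)=\langle r_{d+2},\dots,r_n\rangle$ (trivial if $d=n-1$). For seed point $\omega_n$, a representative $f_d$ is the convex hull of the orbit of $\omega_n$ under $\langle r_{n-d+1},\dots,r_n\rangle$, and $G_s(f_d)=\langle r_1,\dots,r_{n-d-1}\rangle$ (trivial if $d=n-1$). All $d$-dimensional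 faces are $W$-images of the representative, so the order of $G_s(f_d)$ depends only on $d$. *)

(* Defs.v *)
From HB Require Import structures.
From mathcomp Require Import all_boot all_order all_algebra finmap.
From mathcomp Require Import boolp classical_sets functions cardinality.
From mathcomp Require Import reals trigo convex.

Set Implicit Arguments.
Unset Strict Implicit.
Unset Printing Implicit Defensive.

Import Order.TTheory GRing.Theory Num.Theory.
Local Open Scope classical_set_scope.
Local Open Scope ring_scope.

(* On infinite sets the value is the junk value 0. *)
Definition ncard (T : choiceType) (A : set T) : nat := #|` fset_set A|.

(* Subgroups of the group of bijections of T. *)
Definition is_subgroup (T : Type) (H : set (T -> T)) : Prop :=
  [/\ forall f, H f -> bijective f,
      H id,
      forall f g, H f -> H g -> H (f \o g)
    & forall f g, H f -> cancel f g -> cancel g f -> H g].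

Definition pointwise_stabilizer (T : Type) (W : set (T -> T)) (F : set T) :
    set (T -> T) :=
  [set w | W w /\ forall x, F x -> w x = x].

Section Euclidean.
Context {R : realType} {n : nat}.
Implicit Types (x y a : 'rV[R]_n) (A P F : set 'rV[R]_n).

Definition dot x y : R := \sum_i x 0 i * y 0 i.

Definition norm2 x : R := Num.sqrt (dot x x).

Definition refl a x : 'rV[R]_n := x - (2 * dot a x / dot a a) *: a.

Definition convex_hull A : set 'rV[R]_n :=
  smallest (fun C : set 'rV[R]_n => @convex_set R 'rV[R]_n C) A.

(* A is nonempty and the linear span of its differences has dimension d. *)
Definition has_affine_dim (d : nat) A : Prop :=
  A !=set0 /\
  exists U : {vspace 'rV[R]_n},
    [/\ forall x y, A x -> A y -> x - y \in U,
        forall V : {vspace 'rV[R]_n},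
          (forall x y, A x -> A y -> x - y \in V) -> (U <= V)%VS
      & \dim U = d].

(* With c = 0 this includes P itself and the empty set. *)
Definition is_face P F : Prop :=
  exists (c : 'rV[R]_n) (b : R),
    (forall x, P x -> dot c x <= b) /\ F = P `&` [set x | dot c x = b].

Definition faces P (d : nat) : set (set 'rV[R]_n) :=
  [set F | is_face P F /\ has_affine_dim d F].

Definition platonic (W : set ('rV[R]_n -> 'rV[R]_n)) P : Prop :=
  forall d, (d < n)%N -> forall F G, faces P d F -> faces P d G ->
    exists2 w, W w & G = w @` F.

Definition orbit_polytope (W : set ('rV[R]_n -> 'rV[R]_n)) x :
    set 'rV[R]_n :=
  convex_hull [set w x | w in W].

Definition coxeter_group (alpha : 'I_n -> 'rV[R]_n) :
    set ('rV[R]_n -> 'rV[R]_n) :=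
  smallest (@is_subgroup _) [set refl (alpha k) | k in [set: 'I_n]].

(* m is the Coxeter matrix of alpha: distinct simple roots alpha_i, alpha_j
   make the angle pi - pi / m_ij; no condition is put on their lengths. *)
Definition simple_roots (alpha : 'I_n -> 'rV[R]_n) (m : 'I_n -> 'I_n -> nat) :
    Prop :=
  [/\ free [seq alpha i | i <- enum 'I_n],
      forall i, m i i = 1%N,
      forall i j, i != j -> (2 <= m i j)%N
    & forall i j,
        dot (alpha i) (alpha j)
          = - (norm2 (alpha i) * norm2 (alpha j) * cos (pi / (m i j)%:R))].

(* Nodes i and j of the Coxeter-Dynkin diagram are linked when m_ij >= 3. *)
Definition line_diagram (m : 'I_n -> 'I_n -> nat) : Prop :=
  forall i j, (3 <= m i j)%N = (i.+1 == j :> nat) || (j.+1 == i :> nat).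

Definition fundamental_weights (alpha omega : 'I_n -> 'rV[R]_n) : Prop :=
  forall k j,
    2 * dot (omega k) (alpha j) / dot (alpha j) (alpha j) = (k == j)%:R.

End Euclidean.

(* Main.v *)
Require Import Defs.
From mathcomp Require Import all_boot all_order all_algebra finmap.
From mathcomp Require Import boolp classical_sets functions cardinality.
From mathcomp Require Import reals trigo convex.
From mathcomp Require Import interval_inference ring lra zify.

Set Implicit Arguments.
Unset Strict Implicit.
Unset Printing Implicit Defensive.

Import Order.TTheory GRing.Theory Num.Theory.
Local Open Scope classical_set_scope.
Local Open Scope ring_scope.

(** The number of d-faces through a (d-1)-face is an orbit count. The group
    G_s(f_(d-1)) permutes the d-faces that contain f_(d-1); if this action is
    transitive and the stabilizer of f_d in it is G_s(f_d), the quotient of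
    the two orders is the number sought. The Platonic hypothesis writes every
    face as an image of the representative face of its dimension, so both
    facts are only needed for the representative faces ([rep_face]), spanned
    by the orbit of the seed under the first d reflections.

    The stabilizer of f_d is the easy half ([facet_fixed]): an isometry that
    preserves f_d and fixes its facet f_(d-1) pointwise moves each point of
    f_d along f_d and orthogonally to everything it fixes, in particular to
    the edges of the facet and to the center of the facet; no direction of f_d
    but zero is orthogonal to all these.

    Transitivity ([incident_face]) is about the stabilizers of dominant
    vectors. The sum z of the vertices of the representative (d-1)-face is a
    positive multiple of a fundamental weight ([rep_face_center]), so that the
    stabilizer of z is generated by all simple reflections but one. In a line
    diagram, deleting that node leaves two commuting sides: one acts on the
    face, the other is its pointwise stabilizer. If w maps the (d-1)-face into
    the d-face, a suitable u in the group of the d-face makes u w z dominant,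
    whence u w z = z, and w can be replaced by an element of the pointwise
    stabilizer without changing the d-face it defines.

    Both the facts on dominant vectors ([dominant_unique], [dominant_stab],
    [dominant_exposed]) and the description of the faces rest on the theorem
    that an element w with l(w s) >= l(w) sends the simple root of s to a
    positive root ([positive_root]). It is proved by reduction to dihedral
    groups, where sines give all the coefficients ([dihedral_cone]). Group
    elements are represented by words in the simple reflections ([act]).

    The seed at the last node is reduced to the seed at the first one by
    numbering the nodes backwards. *)

(** * Finite sets *)

Lemma exists_minimal_nat (P : nat -> Prop) :
  (exists k, P k) -> exists2 k, P k & forall j, P j -> (k <= j)%N.
Proof.
case=> k Pk; have exP : exists k, `[< P k >] by exists k; apply/asboolP.
case: (ex_minnP exP) => i /asboolP Pi min_i; exists i => // j Pj.
by apply: min_i; apply/asboolP.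
Qed.

Lemma finite_argmax (R : realType) (T : choiceType) (A : set T) (f : T -> R) :
  finite_set A -> A !=set0 -> exists2 x, A x & forall y, A y -> f y <= f x.
Proof.
case/finite_seqP=> r ->; case=> x0 /=; elim: r x0 => // x r IHr x0 _.
case: r IHr => [_|z r /(_ z (mem_head _ _))[x1 rx1 x1_max]].
  by exists x; rewrite /= ?mem_head // => y; rewrite /= inE => /eqP ->.
have [le_x|/ltW le_x1] := leP (f x) (f x1).
  exists x1 => [|y /=]; first by rewrite /= inE rx1 orbT.
  by rewrite inE => /orP[/eqP ->|/x1_max].
exists x => [|y /=]; first by rewrite /= mem_head.
by rewrite inE => /orP[/eqP ->|/x1_max/le_trans->].
Qed.

Lemma ncard_image (T U : choiceType) (A : set T) (f : T -> U) :
  finite_set A -> {in A &, injective f} -> ncard (f @` A) = ncard A.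
Proof.
move=> finA injf; rewrite /ncard fset_set_image // card_in_imfset //= => x y.
by rewrite !in_fset_set //; apply: injf.
Qed.

Lemma ncard_gt0 (T : choiceType) (A : set T) x :
  finite_set A -> A x -> (0 < ncard A)%N.
Proof.
move=> finA Ax; rewrite cardfs_gt0; apply/fset0Pn; exists x.
by rewrite in_fset_set // inE.
Qed.

Lemma ncard_fibers (T U : choiceType) (A : set T) (f : T -> U) N :
  finite_set A ->
  (forall x, A x -> ncard (A `&` [set y | f y = f x]) = N) ->
  ncard A = (ncard (f @` A) * N)%N.
Proof.
move=> finA fib; rewrite /ncard card_fset_sum1 (partition_big_imfset _ f).
rewrite fset_set_image // card_fset_sum1 big_distrl /=.
rewrite big_seq [RHS]big_seq; apply: eq_bigr => _ /imfsetP[x Ax ->].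
rewrite in_fset_set // inE in Ax; rewrite mul1n -(fib x Ax) /ncard.
rewrite card_fset_sum1 big_fset_condE /=.
congr (\big[_/_]_(_ <- enum_fset _) _).
apply/fsetP => y; rewrite in_fset_set; last exact: finite_setIl.
rewrite !inE /= in_fset_set // in_setI; congr (_ && _).
by apply/eqP/idP; rewrite inE.
Qed.

(** * The dot product and reflections *)

Section DotProduct.
Context {R : realType} {n : nat}.
Implicit Types (x y z a : 'rV[R]_n) (c : R).

Lemma dotC x y : dot x y = dot y x.
Proof. by apply: eq_bigr => i _; rewrite mulrC. Qed.

Lemma dotDl x y z : dot (x + y) z = dot x z + dot y z.
Proof. by rewrite -big_split; apply: eq_bigr => i _; rewrite mxE mulrDl. Qed.

Lemma dotDr x y z : dot x (y + z) = dot x y + dot x z.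
Proof. by rewrite dotC dotDl !(dotC x). Qed.

Lemma dotZl c x y : dot (c *: x) y = c * dot x y.
Proof. by rewrite mulr_sumr; apply: eq_bigr => i _; rewrite mxE mulrA. Qed.

Lemma dotZr c x y : dot x (c *: y) = c * dot x y.
Proof. by rewrite dotC dotZl dotC. Qed.

Lemma dotNl x y : dot (- x) y = - dot x y.
Proof. by rewrite -scaleN1r dotZl mulN1r. Qed.

Lemma dotNr x y : dot x (- y) = - dot x y.
Proof. by rewrite dotC dotNl dotC. Qed.

Lemma dotBl x y z : dot (x - y) z = dot x z - dot y z.
Proof. by rewrite dotDl dotNl. Qed.

Lemma dotBr x y z : dot x (y - z) = dot x y - dot x z.
Proof. by rewrite dotDr dotNr. Qed.

Lemma dot0l x : dot 0 x = 0.
Proof. by rewrite -(scale0r 0) dotZl mul0r. Qed.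

Lemma dot_suml (I : Type) (r : seq I) (P : pred I) (f : I -> 'rV[R]_n) y :
  dot (\sum_(i <- r | P i) f i) y = \sum_(i <- r | P i) dot (f i) y.
Proof. by apply: (big_morph (dot^~ y)) => [u v|]; rewrite ?dotDl ?dot0l. Qed.

Lemma dot_sumr (I : Type) (r : seq I) (P : pred I) (f : I -> 'rV[R]_n) y :
  dot y (\sum_(i <- r | P i) f i) = \sum_(i <- r | P i) dot y (f i).
Proof. by rewrite dotC dot_suml; apply: eq_bigr => i _; rewrite dotC. Qed.

Lemma dot_ge0 x : 0 <= dot x x.
Proof. by apply: sumr_ge0 => i _; rewrite -expr2 sqr_ge0. Qed.

Lemma dot_eq0 x : dot x x = 0 -> x = 0.
Proof.
move=> /eqP; rewrite psumr_eq0 => [/allP x0|i _]; last by rewrite -expr2 sqr_ge0.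
apply/rowP => i; rewrite mxE; apply/eqP.
by have := x0 i (mem_index_enum _); rewrite mulf_eq0 orbb.
Qed.

Lemma reflD a x y : refl a (x + y) = refl a x + refl a y.
Proof. by rewrite /refl dotDr mulrDr mulrDl scalerDl opprD addrACA. Qed.

Lemma reflZ a c x : refl a (c *: x) = c *: refl a x.
Proof. by rewrite /refl dotZr scalerBr scalerA; congr (_ - _ *: _); ring. Qed.

Lemma refl_scale c a : c != 0 -> refl (c *: a) = refl a.
Proof.
move=> c0; apply/funext => x; rewrite /refl !dotZl dotZr scalerA.
congr (_ - _ *: _).
have [->|a0] := eqVneq (dot a a) 0; first by rewrite !mulr0 !invr0 !mulr0 mul0r.
by field; rewrite c0 a0.
Qed.

End DotProduct.

(** * Convex hulls *)

Section ConvexHull.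
Context {R : realType} {n : nat}.

Lemma hull_sub (A C : set 'rV[R]_n) : A `<=` C ->
  (forall x y t, 0 < t -> t < 1 -> C x -> C y -> C (t *: x + (1 - t) *: y)) ->
  convex_hull A `<=` C.
Proof.
move=> AC convC x; apply; split=> //; apply/convex_setW => y z.
rewrite !inE => Cy Cz t t0 t1; rewrite inE.
exact: convC.
Qed.

Lemma sub_hull (A : set 'rV[R]_n) : A `<=` convex_hull A.
Proof. exact: sub_gen_smallest. Qed.

Lemma hull_conv (A : set 'rV[R]_n) x y t : 0 < t -> t < 1 ->
  convex_hull A x -> convex_hull A y -> convex_hull A (t *: x + (1 - t) *: y).
Proof.
move=> t0 t1 Ax Ay C [convC AC].
have t01 : 0 <= t <= 1 by rewrite !ltW.
have := convC x y (Itv01 (ltW t0) (ltW t1)); rewrite !inE => convt.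
by apply: convt; [apply: Ax|apply: Ay].
Qed.

End ConvexHull.

(** * Words in the simple reflections *)

Section Words.
Context {R : realType} {n : nat} (e : 'I_n -> 'rV[R]_n).
Hypothesis e_unit : forall i, dot (e i) (e i) = 1.
Hypothesis e_indep :
  forall c : 'I_n -> R, \sum_i c i *: e i = 0 -> forall i, c i = 0.

Implicit Types (x y : 'rV[R]_n) (u v : seq 'I_n) (J K : pred 'I_n).

Lemma reflE i x : refl (e i) x = x - (2 * dot (e i) x) *: e i.
Proof. by rewrite /refl e_unit divr1. Qed.

Lemma refl_self i : refl (e i) (e i) = - e i.
Proof. by rewrite reflE e_unit; apply/rowP => j; rewrite !mxE; ring. Qed.

Lemma reflK i : involutive (refl (e i)).
Proof.
move=> x; rewrite !reflE dotBr dotZr e_unit.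
by apply/rowP => j; rewrite !mxE; ring.
Qed.

Lemma refl_fix i x : dot (e i) x = 0 -> refl (e i) x = x.
Proof. by rewrite reflE => ->; rewrite mulr0 scale0r subr0. Qed.

Lemma dot_refl i x y : dot (refl (e i) x) (refl (e i) y) = dot x y.
Proof.
rewrite !reflE !(dotBl, dotBr, dotZl, dotZr) e_unit (dotC x (e i)).
ring.
Qed.

Definition act u x := foldr (fun i => refl (e i)) x u.

Lemma act_cons i u x : act (i :: u) x = refl (e i) (act u x).
Proof. by []. Qed.

Lemma act_cat u v x : act (u ++ v) x = act u (act v x).
Proof. by rewrite /act foldr_cat. Qed.

Lemma act_rcons u i x : act (rcons u i) x = act u (refl (e i) x).
Proof. by rewrite -cats1 act_cat. Qed.

Lemma actD u x y : act u (x + y) = act u x + act u y.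
Proof. by elim: u => // i u IHu; rewrite !act_cons IHu reflD. Qed.

Lemma actZ u c x : act u (c *: x) = c *: act u x.
Proof. by elim: u => // i u IHu; rewrite !act_cons IHu reflZ. Qed.

Lemma actN u x : act u (- x) = - act u x.
Proof. by rewrite -scaleN1r actZ scaleN1r. Qed.

Lemma actB u x y : act u (x - y) = act u x - act u y.
Proof. by rewrite actD actN. Qed.

Lemma act0 u : act u 0 = 0.
Proof. by rewrite -[X in act _ X](scale0r 0) actZ scale0r. Qed.

Lemma act_sum u (I : Type) (r : seq I) (P : pred I) (f : I -> 'rV[R]_n) :
  act u (\sum_(i <- r | P i) f i) = \sum_(i <- r | P i) act u (f i).
Proof. exact: (big_morph (act u) (actD u) (act0 u)). Qed.

Lemma dot_act u x y : dot (act u x) (act u y) = dot x y.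
Proof. by elim: u => // i u IHu; rewrite !act_cons dot_refl. Qed.

Lemma act_revK u : cancel (act u) (act (rev u)).
Proof.
by elim: u => // i u IHu x; rewrite rev_cons act_cons act_rcons reflK.
Qed.

Lemma act_Krev u : cancel (act (rev u)) (act u).
Proof. by move=> x; rewrite -{1}(revK u) act_revK. Qed.

Lemma act_inj u : injective (act u).
Proof. exact: can_inj (act_revK u). Qed.

Lemma dot_act_adj u x y : dot (act u x) y = dot x (act (rev u) y).
Proof. by rewrite -{1}(act_Krev u y) dot_act. Qed.

Lemma image_act_cat u v (A : set 'rV[R]_n) :
  [set act (u ++ v) x | x in A] = [set act u x | x in [set act v x | x in A]].
Proof. by rewrite image_comp; apply: eq_imagel => x _; rewrite act_cat. Qed.

Lemma image_act_revK u (A : set 'rV[R]_n) :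
  [set act (rev u) x | x in [set act u x | x in A]] = A.
Proof.
by rewrite -image_act_cat -[RHS]image_id; apply: eq_imagel => x _;
  rewrite act_cat act_revK.
Qed.

Lemma image_act_Krev u (A : set 'rV[R]_n) :
  [set act u x | x in [set act (rev u) x | x in A]] = A.
Proof. by have := image_act_revK (rev u) A; rewrite revK. Qed.

Lemma act_fix u x : (forall i, i \in u -> dot (e i) x = 0) -> act u x = x.
Proof.
elim: u => // i u IHu ux; rewrite act_cons IHu => [|j ju]; last first.
  by apply: ux; rewrite inE ju orbT.
by rewrite refl_fix // ux // mem_head.
Qed.

(** * Spans and cones of roots *)

Definition span J x := exists2 c : 'I_n -> R,
  forall i, ~~ J i -> c i = 0 & x = \sum_i c i *: e i.

Definition cone J x := exists2 c : 'I_n -> R,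
  (forall i, 0 <= c i) /\ (forall i, ~~ J i -> c i = 0) & x = \sum_i c i *: e i.

Lemma cone_span J x : cone J x -> span J x.
Proof. by case=> c [_ cJ] ->; exists c. Qed.

Lemma span0 J : span J 0.
Proof. by exists (fun=> 0) => //; rewrite big1 // => i _; rewrite scale0r. Qed.

Lemma spanD J x y : span J x -> span J y -> span J (x + y).
Proof.
case=> c cJ ->; case=> d dJ ->; exists (fun i => c i + d i) => [i Ji|].
  by rewrite cJ // dJ // addr0.
by rewrite -big_split; apply: eq_bigr => i _; rewrite scalerDl.
Qed.

Lemma spanZ J a x : span J x -> span J (a *: x).
Proof.
case=> c cJ ->; exists (fun i => a * c i) => [i Ji|].
  by rewrite cJ // mulr0.
by rewrite scaler_sumr; apply: eq_bigr => i _; rewrite scalerA.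
Qed.

Lemma spanB J x y : span J x -> span J y -> span J (x - y).
Proof. by move=> xJ yJ; rewrite -scaleN1r; apply: spanD => //; apply: spanZ. Qed.

Lemma sum_delta (k : 'I_n) (a : R) :
  \sum_i (if i == k then a else 0) *: e i = a *: e k.
Proof.
rewrite (bigD1 k) //= eqxx big1 ?addr0 // => i /negbTE ->.
by rewrite scale0r.
Qed.

Lemma span_gen J i : J i -> span J (e i).
Proof.
move=> Ji; exists (fun j => if j == i then 1 else 0) => [j|].
  by case: eqP => // ->; rewrite Ji.
by rewrite sum_delta scale1r.
Qed.

Lemma cone0 J : cone J 0.
Proof.
by exists (fun=> 0) => //; rewrite big1 // => i _; rewrite scale0r.
Qed.

Lemma coneD J x y : cone J x -> cone J y -> cone J (x + y).
Proof.
case=> c [c0 cJ] ->; case=> d [d0 dJ] ->; exists (fun i => c i + d i).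
  by split=> i => [|Ji]; rewrite ?addr_ge0 // cJ // dJ // addr0.
by rewrite -big_split; apply: eq_bigr => i _; rewrite scalerDl.
Qed.

Lemma coneZ J a x : 0 <= a -> cone J x -> cone J (a *: x).
Proof.
move=> a0; case=> c [c0 cJ] ->; exists (fun i => a * c i).
  by split=> i => [|Ji]; rewrite ?mulr_ge0 // cJ // mulr0.
by rewrite scaler_sumr; apply: eq_bigr => i _; rewrite scalerA.
Qed.

Lemma cone_gen J i : J i -> cone J (e i).
Proof.
move=> Ji; exists (fun j => if j == i then 1 else 0).
  by split=> j; case: eqP => // ->; rewrite Ji.
by rewrite sum_delta scale1r.
Qed.

Lemma cone_antisym J x : cone J x -> cone J (- x) -> x = 0.
Proof.
case=> c [c0 _] xc [d [d0 _] xd]; rewrite xc big1 // => i _.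
have /e_indep/(_ i) cd0 : \sum_i (c i + d i) *: e i = 0.
  under eq_bigr do rewrite scalerDl.
  by rewrite big_split /= -xc -xd subrr.
by have := c0 i; have := d0 i => ? ?; rewrite (_ : c i = 0) ?scale0r //; lra.
Qed.

Lemma span_perp0 J x : span J x -> (forall i, J i -> dot x (e i) = 0) -> x = 0.
Proof.
case=> c cJ xc xJ; apply: dot_eq0; rewrite {2}xc dot_sumr big1 // => i _.
by rewrite dotZr; have [/xJ ->|/cJ ->] := boolP (J i); rewrite ?mulr0 ?mul0r.
Qed.

Lemma act_span J u x : all J u -> span J (act u x - x).
Proof.
elim: u => [_|i u IHu]; first by rewrite /= subrr; exact: span0.
rewrite act_cons [all _ _]/= => /andP[Ji /IHu uJ].
by rewrite reflE addrAC; apply: spanB => //; apply/spanZ/span_gen.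
Qed.

(** An element of the group generated by the reflections in J moves every
    vector along the span of the roots in J, and it fixes the orthogonal
    complement of that span; so its values on these roots determine it. *)
Lemma eq_act J u v : all J u -> all J v ->
  (forall i, J i -> act u (e i) = act v (e i)) -> act u =1 act v.
Proof.
move=> uJ vJ uv x; apply/eqP; rewrite -subr_eq0; apply/eqP.
apply: (@act_inj (rev v)); rewrite act0 actB act_revK.
apply: (@span_perp0 J) => [|i Ji].
  rewrite -act_cat; apply: act_span; rewrite all_cat all_rev vJ //.
rewrite dotBl dot_act_adj revK -uv // dot_act.
by rewrite subrr.
Qed.

(** * Dihedral subgroups *)

Section Dihedral.
Variable m : nat.
Hypothesis m_ge2 : (2 <= m)%N.
Let theta : R := pi / m%:R.

Fixpoint alt p (a b : 'I_n) :=
  if p is q.+1 then rcons (alt q b a) a else [::].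

Lemma size_alt p a b : size (alt p a b) = p.
Proof. by elim: p a b => //= p IHp a b; rewrite size_rcons IHp. Qed.

Lemma alt_all p a b : all (mem [:: a; b]) (alt p a b).
Proof.
elim: p a b => //= p IHp a b; rewrite all_rcons /= inE eqxx /=.
by apply: sub_all (IHp b a) => i; rewrite /= !inE orbC.
Qed.

Lemma alt_cons p a b :
  alt p.+1 a b = (if odd p then b else a) :: alt p a b.
Proof.
elim: p a b => // p IHp a b; rewrite [LHS]/= -/(alt p.+1 b a) IHp rcons_cons.
by rewrite /=; case: (odd p).
Qed.

Lemma alt_add p q a b :
  alt (q + p) a b = (if odd p then alt q b a else alt q a b) ++ alt p a b.
Proof.
elim: p a b => [|p IHp] a b; first by rewrite addn0 cats0.
by rewrite addnS /= IHp rcons_cat; case: (odd p).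
Qed.

(** With e a and e b at the angle pi - theta, this is sin theta times the
    vector obtained by turning e a by q theta towards e b. *)
Let vec q a b := sin (q.+1%:R * theta) *: e a + sin (q%:R * theta) *: e b.

Lemma refl_vec q a b : dot (e a) (e b) = - cos theta ->
  refl (e b) (vec q a b) = vec q.+1 b a.
Proof.
move=> ab; have S2 : sin (q.+2%:R * theta) =
    2 * cos theta * sin (q.+1%:R * theta) - sin (q%:R * theta).
  rewrite (_ : q.+2%:R * theta = q.+1%:R * theta + theta); last first.
    by rewrite -[q.+2%:R]natr1; ring.
  rewrite (_ : q%:R * theta = q.+1%:R * theta - theta); last first.
    by rewrite -[q.+1%:R]natr1; ring.
  by rewrite sinD sinB; ring.
rewrite /vec reflE dotDr !dotZr e_unit (dotC _ (e a)) ab S2.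
by apply/rowP => i; rewrite !mxE; ring.
Qed.

Lemma act_alt_vec p q a b : dot (e a) (e b) = - cos theta ->
  act (alt p b a) (vec q a b) =
  if odd p then vec (q + p) b a else vec (q + p) a b.
Proof.
elim: p q a b => [|p IHp] q a b ab /=; first by rewrite addn0.
by rewrite act_rcons refl_vec // IHp ?addSnnS; [case: (odd p)|rewrite dotC].
Qed.

Let m_gt0 : 0 < m%:R :> R.
Proof. by rewrite ltr0n; apply: leq_trans m_ge2. Qed.

Let theta_gt0 : 0 < theta.
Proof. by rewrite divr_gt0 ?pi_gt0. Qed.

Let m_theta : m%:R * theta = pi.
Proof. by rewrite mulrC divfK // gt_eqF. Qed.

Let sin_theta_gt0 : 0 < sin theta.
Proof.
apply: sin_gt0_pi; rewrite theta_gt0 -m_theta ltr_pMl // ltr1n.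
exact: m_ge2.
Qed.

Lemma sin_mul_ge0 q : (q <= m)%N -> 0 <= sin (q%:R * theta).
Proof.
move=> qm; apply: sin_ge0_pi; rewrite mulr_ge0 ?ler0n ?(ltW theta_gt0) //=.
by rewrite -m_theta ler_wpM2r ?(ltW theta_gt0) // ler_nat.
Qed.

Let vec0 a b : vec 0 a b = sin theta *: e a.
Proof. by rewrite /vec mul1r mul0r sin0 scale0r addr0. Qed.

Let vec_m a b : vec m a b = - (sin theta *: e a).
Proof.
rewrite /vec -natr1 mulrDl mul1r m_theta sinD sinpi cospi scale0r addr0.
by rewrite -scaleNr; congr (_ *: _); ring.
Qed.

Let vec_pred_m a b : vec m.-1 a b = sin theta *: e b.
Proof.
have m1 : m.-1.+1 = m by rewrite prednK // (leq_trans _ m_ge2).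
rewrite /vec m1 m_theta sinpi scale0r add0r.
rewrite (_ : m.-1%:R = m%:R - 1); last by rewrite -[in RHS]m1 -natr1 addrK.
rewrite mulrBl m_theta mul1r sinB sinpi cospi; congr (_ *: _); ring.
Qed.

Let braid_root a b : dot (e a) (e b) = - cos theta ->
  act (alt m b a) (e a) = act (alt m a b) (e a).
Proof.
move=> ab; have m1 : m = m.-1.+1 by rewrite prednK // (leq_trans _ m_ge2).
have s0 : sin theta != 0 by rewrite gt_eqF.
apply: (scalerI s0); rewrite -!actZ -[in LHS](vec0 a b) act_alt_vec // add0n.
have -> : alt m a b = rcons (alt m.-1 b a) a by rewrite {1}m1.
rewrite act_rcons reflZ refl_self scalerN actN.
rewrite -(vec0 a b) act_alt_vec // add0n !vec_m !vec_pred_m.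
by rewrite {1}m1 /=; case: (odd m.-1).
Qed.

(** The braid relation: both sides agree on the two roots by the sine
    formula, hence everywhere. *)
Lemma braid a b : dot (e a) (e b) = - cos theta ->
  act (alt m b a) =1 act (alt m a b).
Proof.
move=> ab; apply: (@eq_act (mem [:: a; b])).
- by apply: sub_all (alt_all m b a) => i; rewrite /= !inE orbC.
- exact: alt_all.
move=> i; rewrite /= !inE => /orP[] /eqP ->; first exact: braid_root.
by symmetry; apply: braid_root; rewrite dotC.
Qed.

Variables s t : 'I_n.
Hypothesis st : dot (e s) (e t) = - cos theta.
Let D : pred 'I_n := mem [:: s; t].

(** Two equal neighbouring letters would cancel. *)
Lemma reduced_alt w a b : D =1 mem [:: a; b] -> all D w ->
  (forall w', all D w' -> act w' =1 act w -> (size w <= size w')%N) ->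
  (forall w', w <> rcons w' a) -> w = alt (size w) b a.
Proof.
elim/last_ind: w a b => // w c IHw a b Dab; rewrite all_rcons => /andP[Dc Dw].
move=> w_red last_c.
have cb : c = b.
  move: Dc; rewrite Dab /= !inE => /orP[/eqP ca|/eqP //].
  by case: (last_c w); rewrite ca.
rewrite size_rcons /= cb; congr rcons; apply: IHw => // [i|w' Dw' w'w|w' ww'].
- by rewrite Dab /= !inE orbC.
- have := w_red (rcons w' c); rewrite all_rcons Dc Dw' !size_rcons ltnS.
  by apply=> // x; rewrite !act_rcons w'w.
have : (size (rcons w c) <= size w')%N.
  apply: w_red => [|x]; first by move: Dw; rewrite ww' all_rcons => /andP[].
  by rewrite ww' cb !act_rcons reflK.
by rewrite ww' !size_rcons ltnNge leqnSn.
Qed.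

(** In rank two, a shortest word that appending s does not shorten sends the
    root of s to a nonnegative combination of the two roots: the word
    alternates, has fewer than m letters because of the braid relation, and
    the sine formula has no negative coefficient below length m. *)
Lemma dihedral_cone w : all D w ->
  (forall w', all D w' -> act w' =1 act w -> (size w <= size w')%N) ->
  (forall w', all D w' -> act w' =1 act (rcons w s) -> (size w <= size w')%N) ->
  cone D (act w (e s)).
Proof.
move=> Dw w_red ws_red.
have Ds : D s by rewrite /D /= inE eqxx.
have w_alt : w = alt (size w) t s.
  apply: reduced_alt => // w' ww'; move: Dw (ws_red w').
  rewrite ww' all_rcons => /andP[_ Dw'] /(_ Dw'); rewrite size_rcons ltnn.
  move=> ww_red; suff: false by []; apply: ww_red => x.
  by rewrite !act_rcons reflK.
have altD p : all D (alt p s t) by exact: alt_all.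
have altD' p : all D (alt p t s).
  by apply: sub_all (alt_all p t s) => i; rewrite /D /= !inE orbC.
have m1 : m = m.-1.+1 by rewrite prednK // (leq_trans _ m_ge2).
have w_lt_m : (size w < m)%N.
  rewrite ltnNge; apply/negP; rewrite leq_eqVlt => /orP[/eqP mw|mw].
    (* At length m the braid relation makes s the last letter, and s cancels. *)
    have := ws_red (alt m.-1 t s) (altD' _); rewrite size_alt -mw.
    move=> ww_red; suff: (m <= m.-1)%N by rewrite {1}m1 ltnn.
    apply: ww_red => x.
    by rewrite w_alt act_rcons -mw braid // [in RHS]m1 /= act_rcons reflK.
  (* Beyond length m it makes two equal letters meet in front of the last
     m letters. *)
  pose k := (size w - m.+1)%N.
  have wk : (size w = k + m.+1)%N by rewrite subnK.
  pose pre := if odd m.+1 then alt k s t else alt k t s.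
  have wpre : w = pre ++ alt m.+1 t s by rewrite w_alt wk alt_add.
  have := w_red (pre ++ alt m.-1 s t); rewrite all_cat altD andbT.
  have -> : all D pre by rewrite /pre; case: ifP.
  rewrite wpre !size_cat !size_alt leq_add2l.
  rewrite leqNgt ltnS leq_pred => w_red'; suff: false by [].
  apply: w_red' => // x.
  rewrite !act_cat; congr act; rewrite alt_cons /= braid //.
  have -> : alt m s t = alt m.-1.+1 s t by rewrite -m1.
  have odd_m : odd m = ~~ odd m.-1 by rewrite {1}m1.
  rewrite alt_cons odd_m act_cons.
  by case: (odd m.-1); rewrite /= reflK.
(* The coefficients of vec (size w), divided by sin theta. *)
exists (fun i => (if i == s then if odd (size w) then sin ((size w)%:R * theta)
    else sin ((size w).+1%:R * theta) else 0) / sin theta +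
  (if i == t then if odd (size w) then sin ((size w).+1%:R * theta)
    else sin ((size w)%:R * theta) else 0) / sin theta).
  split=> i => [|].
    apply: addr_ge0; apply: divr_ge0; rewrite ?(ltW sin_theta_gt0) //;
      by do ?case: ifP => // _; rewrite sin_mul_ge0 // ltnW.
  rewrite /D /= !inE negb_or => /andP[/negbTE -> /negbTE ->].
  by rewrite mul0r addr0.
have s0 : sin theta != 0 by rewrite gt_eqF.
apply: (scalerI s0).
under eq_bigr do rewrite scalerDl.
rewrite big_split /= scalerDr !scaler_sumr.
under eq_bigr do rewrite scalerA mulrC (divfK s0).
rewrite sum_delta; under eq_bigr do rewrite scalerA mulrC (divfK s0).
rewrite sum_delta -actZ -(vec0 s t) {1}w_alt act_alt_vec // add0n /vec.
by case: ifP => // _; rewrite addrC.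
Qed.

End Dihedral.

(** * Positivity of roots *)

Lemma cone_act J K v x : (forall i, J i -> cone K (act v (e i))) ->
  cone J x -> cone K (act v x).
Proof.
move=> vJ [c [c0 cJ] ->]; rewrite act_sum.
elim/big_rec: _ => [|i y _ yK]; first exact: cone0.
apply: coneD => //; rewrite actZ.
have [/vJ|/cJ ->] := boolP (J i); first exact: coneZ.
by rewrite scale0r; apply: cone0.
Qed.

Variable m : 'I_n -> 'I_n -> nat.
Hypothesis m_ge2 : forall i j, i != j -> (2 <= m i j)%N.
Hypothesis e_coxeter :
  forall i j, i != j -> dot (e i) (e j) = - cos (pi / (m i j)%:R).

Fact len_subproof u :
  exists2 k, (exists2 v, act v =1 act u & size v = k) &
    forall j, (exists2 v, act v =1 act u & size v = j) -> (k <= j)%N.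
Proof. by apply: exists_minimal_nat; exists (size u); exists u. Qed.

Definition len u := s2val (cid2 (len_subproof u)).

Lemma len_le u v : act v =1 act u -> (len u <= size v)%N.
Proof. by move=> vu; apply: (s2valP' (cid2 (len_subproof u))); exists v. Qed.

Lemma reduced_word u : exists2 v, act v =1 act u & size v = len u.
Proof. exact: (s2valP (cid2 (len_subproof u))). Qed.

Lemma len_le_cat u v w :
  act (v ++ w) =1 act u -> (len u <= len v + size w)%N.
Proof.
move=> vwu; have [v' v'v <-] := reduced_word v; rewrite -size_cat.
by apply: len_le => x; rewrite -vwu !act_cat v'v.
Qed.

(** If appending s to a word does not shorten it, the word sends the simple
    root of s to a positive root. Strip from the word the longest possible
    ending in the dihedral group of s and of the last letter t: what remains
    is shorter and cannot be shortened by s or t, so it keeps both simple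
    roots positive by induction, and the rank two case handles the ending. *)
Lemma positive_root u s :
  (len u <= len (rcons u s))%N -> cone predT (act u (e s)).
Proof.
have [k] := ubnP (len u); elim: k u s => // k IHk u s u_lt_k u_up.
have [v0 v0u size_v0] := reduced_word u.
case/lastP: v0 => [|v1 t] in v0u size_v0.
  by rewrite -v0u; apply: cone_gen.
rewrite size_rcons in size_v0.
have st : s != t.
  apply/eqP => st; have : (len (rcons u s) <= size v1)%N.
    by apply: len_le => x; rewrite act_rcons -v0u act_rcons st reflK.
  by move/(leq_trans u_up); rewrite -size_v0 ltnn.
pose D : pred 'I_n := mem [:: s; t].
pose Q l := exists v w,
  [/\ all D w, act (v ++ w) =1 act u, (len v + size w <= len u)%N & len v = l].
have Q1 : Q (len v1).
  exists v1, [:: t]; rewrite /D /= !inE eqxx orbT cats1 addn1 -size_v0 ltnS.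
  by split=> //; apply: len_le.
have [l [v [w [Dw vwu le_vw vl]]] min_l] :=
  exists_minimal_nat (ex_intro _ _ Q1).
have v_lt_u : (len v < len u)%N.
  by rewrite vl -size_v0 ltnS (leq_trans (min_l _ Q1)) // len_le.
have v_up r : D r -> (len v <= len (rcons v r))%N.
  move=> Dr; rewrite leqNgt; apply/negP => lt_vr.
  have /min_l : Q (len (rcons v r)).
    exists (rcons v r), (r :: w); split=> //; first by rewrite /= Dr.
      by move=> x; rewrite act_cat act_rcons act_cons reflK -act_cat.
    by rewrite /= addnS -addSn (leq_trans _ le_vw) // leq_add2r.
  by rewrite -vl leqNgt lt_vr.
rewrite -vwu act_cat; apply: (@cone_act D) => [r Dr|].
  by apply: IHk; [rewrite (leq_trans v_lt_u)|apply: v_up].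
apply: (dihedral_cone (m_ge2 st)) => [||w' Dw' w'w|w' Dw' w'w] //.
- exact: e_coxeter.
- rewrite -(leq_add2l (len v)) (leq_trans le_vw) // len_le_cat // => x.
  by rewrite -vwu !act_cat w'w.
- rewrite -(leq_add2l (len v)) (leq_trans le_vw) // (leq_trans u_up) //.
  by rewrite len_le_cat // => x; rewrite act_cat w'w !act_rcons -vwu act_cat.
Qed.

(** Every element has a word that lengthens at each letter, so that each
    letter contributes a positive root: an induction principle in which
    lengths no longer appear. *)
Lemma positive_ind (Q : seq 'I_n -> Prop) :
  (forall u v, act u =1 act v -> Q u -> Q v) -> Q [::] ->
  (forall v s, cone predT (act v (e s)) -> Q v -> Q (rcons v s)) ->
  forall u, Q u.
Proof.
move=> Qeq Q0 Qs u; have [k] := ubnP (len u); elim: k u => // k IHk u u_lt.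
have [v] := reduced_word u; case/lastP: v => [|v s] vu size_v.
  exact: Qeq vu Q0.
rewrite size_rcons in size_v.
have le_v : (len v <= size v)%N by apply: len_le.
have vs : len (rcons v s) = len u.
  apply/eqP; rewrite eqn_leq -{1}size_v -(size_rcons v s) len_le //=.
  have [w ws <-] := reduced_word (rcons v s).
  by apply: len_le => x; rewrite ws vu.
apply: (Qeq _ _ vu); apply: Qs; last first.
  by apply: IHk; rewrite (leq_ltn_trans le_v) // size_v -ltnS.
by apply: positive_root; rewrite vs -size_v (leq_trans le_v).
Qed.

(** * Dominant vectors *)

Definition dominant x := forall i, 0 <= dot x (e i).

Lemma e_dot_le0 i j : i != j -> dot (e i) (e j) <= 0.
Proof.
move=> ij; rewrite e_coxeter // oppr_le0; apply: cos_ge0_pihalf.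
have pi0 := pi_gt0 R; have m0 : 0 < (m i j)%:R :> R.
  by rewrite ltr0n (leq_trans _ (m_ge2 ij)).
apply/andP; split.
  by rewrite (@le_trans _ _ 0) ?oppr_le0 ?divr_ge0 ?(ltW pi0) ?(ltW m0).
by rewrite ler_pM2l // lef_pV2 ?posrE // ler_nat m_ge2.
Qed.

Lemma act_rcons_sub v s x :
  x - act (rcons v s) x = (x - act v x) + (2 * dot x (e s)) *: act v (e s).
Proof.
rewrite act_rcons reflE actB actZ (dotC (e s)).
by rewrite opprB addrA addrAC.
Qed.

(** Appending a letter to a word that it lengthens subtracts from the image of
    x a nonnegative multiple of a positive root. *)
Lemma dominant_cone u x : dominant x -> cone predT (x - act u x).
Proof.
move=> x_dom; elim/positive_ind: u => [u v uv|| v s vs IHv].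
- by rewrite uv.
- by rewrite subrr; apply: cone0.
rewrite act_rcons_sub; apply: coneD => //; apply: coneZ => //.
by rewrite mulr_ge0.
Qed.

(** Each of two dominant vectors of an orbit exceeds the other by a nonnegative
    combination of roots. *)
Lemma dominant_unique u x : dominant x -> dominant (act u x) -> act u x = x.
Proof.
move=> x_dom ux_dom; apply/eqP; rewrite -subr_eq0; apply/eqP.
apply: (@cone_antisym predT); last by rewrite opprB; apply: dominant_cone.
by have := dominant_cone (rev u) ux_dom; rewrite act_revK.
Qed.

(** Along a lengthening word the losses in [dominant_cone] add up without
    cancellation; if x comes back to itself, each of them is zero, and a zero
    loss comes from a letter that fixes x. *)
Lemma dominant_stab u x : dominant x -> act u x = x ->
  exists2 v, all (fun i => dot x (e i) == 0) v & act v =1 act u.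
Proof.
move=> x_dom; elim/positive_ind: u => [u v uv IHu|| v s vs IHv].
- by rewrite -uv => /IHu[w xw wu]; exists w => // y; rewrite wu uv.
- by exists [::].
move=> vsx.
have cone1 := dominant_cone v x_dom.
have cone2 : cone predT ((2 * dot x (e s)) *: act v (e s)).
  by apply: coneZ => //; rewrite mulr_ge0.
have := act_rcons_sub v s x; rewrite vsx subrr => /esym/eqP sum0.
have vx : act v x = x.
  apply/eqP; rewrite eq_sym -subr_eq0; apply/eqP.
  apply: (cone_antisym cone1); move: sum0; rewrite addr_eq0 => /eqP ->.
  by rewrite opprK.
have [w xw wv] := IHv vx; exists (rcons w s); last first.
  by move=> y; rewrite !act_rcons wv.
rewrite all_rcons xw andbT.
move: sum0; rewrite vx subrr add0r scaler_eq0 => /orP[|/eqP vs0].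
  by rewrite mulf_eq0 pnatr_eq0.
have := e_unit s; rewrite -(dot_act v) vs0 dot0l => /esym/eqP.
by rewrite oner_eq0.
Qed.

Hypothesis W_finite : finite_set [set act u | u in [set: seq 'I_n]].

Lemma finite_orbit (A : set (seq 'I_n)) x : finite_set [set act u x | u in A].
Proof.
apply: (@sub_finite_set _ _ [set w x | w in [set act u | u in setT]]).
  by move=> _ [u _ <-]; exists (act u) => //; exists u.
exact: finite_image.
Qed.

Variable rho : 'rV[R]_n.
Hypothesis rho_gt0 : forall i, 0 < dot rho (e i).

(** In the vector of the orbit with the largest product with rho no root of J
    has a negative product: reflecting in that root would raise it. *)
Lemma make_dominant J x :
  exists2 u, all J u & forall i, J i -> 0 <= dot (act u x) (e i).
Proof.
have [|_ [u uJ <-] u_max] := @finite_argmax _ _ _ (dot rho)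
  (finite_orbit [set u | all J u] x); first by exists x; exists [::].
exists u => // i Ji; have /u_max : [set act u x | u in [set u | all J u]]
    (act (i :: u) x) by exists (i :: u) => //=; rewrite Ji.
rewrite act_cons reflE dotBr dotZr gerBl => rho_le.
have : 0 <= 2 * dot (e i) (act u x) by rewrite -(pmulr_lge0 _ (rho_gt0 i)).
by rewrite pmulr_rge0 // dotC.
Qed.

(** This finds the vertices of the face of the orbit polytope exposed by c.
    Make the image of x nonnegative on the roots orthogonal to c, by
    reflections that fix c. Its difference with x is then a combination of
    these roots only, so the product with any other simple root has not
    decreased: the image is dominant, hence equal to x. *)
Lemma dominant_exposed u c x : dominant c -> dominant x ->
  dot c (act u x) = dot c x ->
  exists2 v, all (fun i => dot c (e i) == 0) v & act u x = act v x.
Proof.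
move=> c_dom x_dom cux; pose J : pred 'I_n := fun i => dot c (e i) == 0.
rewrite -/J.
have [w wJ wux_dom] := make_dominant J (act u x).
exists (rev w); first by rewrite all_rev.
suff wux : act (w ++ u) x = x by rewrite -[in RHS]wux act_cat act_revK.
apply: dominant_unique => // i.
have wc : act (rev w) c = c.
  apply: act_fix => j; rewrite mem_rev => jw; apply/eqP.
  by have := allP wJ _ jw; rewrite dotC.
have [d [d0 _] xd] := dominant_cone (w ++ u) x_dom.
have [/wux_dom|] := boolP (J i); first by rewrite act_cat.
move=> Ji; have di0 : d i = 0.
  have : dot c (x - act (w ++ u) x) = 0.
    rewrite dotBr act_cat (dotC c (act w _)) dot_act_adj wc.
    by rewrite (dotC (act u x)) cux subrr.
  rewrite xd dot_sumr => /eqP; rewrite psumr_eq0 => [/allP/(_ i)|j _]; last first.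
    by rewrite dotZr mulr_ge0.
  rewrite mem_index_enum dotZr mulf_eq0 => /(_ isT)/orP[/eqP //|].
  by move/negP: Ji.
rewrite -[act _ x](subKr x) xd dotBl subr_ge0 (le_trans _ (x_dom i)) //.
rewrite dot_suml (bigD1 i) //= di0 scale0r dot0l add0r sumr_le0 // => j ji.
by rewrite dotZl mulr_ge0_le0 // e_dot_le0.
Qed.

(** * Representative faces *)

Lemma hull_act u (A B : set 'rV[R]_n) : (forall x, A x -> B (act u x)) ->
  forall x, convex_hull A x -> convex_hull B (act u x).
Proof.
move=> AB; apply: hull_sub => [x /AB|x y t t0 t1 Bx By]; first exact: sub_hull.
by rewrite actD !actZ; apply: hull_conv.
Qed.

Hypothesis e_far : forall i j : 'I_n, (i.+1 < j)%N -> dot (e i) (e j) = 0.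
Hypothesis e_near : forall i j : 'I_n, i.+1 = j -> dot (e i) (e j) < 0.

Variable p : 'rV[R]_n.
Hypothesis p_perp : forall i : 'I_n, (0 < i)%N -> dot p (e i) = 0.
Hypothesis p_gt0 : forall i : 'I_n, i = 0 :> nat -> 0 < dot p (e i).

Definition below k : pred 'I_n := fun i => (i < k)%N.
Definition above k : pred 'I_n := fun i => (k < i)%N.

Definition vertices d : set 'rV[R]_n :=
  [set act u p | u in [set u | all (below d) u]].

Definition rep_face d : set 'rV[R]_n := convex_hull (vertices d).

Lemma vertices_sub d k : (d <= k)%N -> vertices d `<=` vertices k.
Proof.
move=> dk _ [u du <-]; exists u => //=; apply: sub_all du => i id.
exact: leq_trans id dk.
Qed.

Lemma rep_face_sub d k : (d <= k)%N -> rep_face d `<=` rep_face k.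
Proof.
move=> dk; apply: hull_sub => [x /(vertices_sub dk)|x y t].
  exact: sub_hull.
exact: hull_conv.
Qed.

Lemma p_dominant : dominant p.
Proof. by move=> i; case: (posnP i) => [/p_gt0/ltW|/p_perp ->]. Qed.

Lemma cone_span_cone J x : cone predT x -> span J x -> cone J x.
Proof.
case=> c [c0 _] xc [d dJ xd]; exists c => //; split=> // i Ji.
have /e_indep/(_ i) : \sum_i (c i - d i) *: e i = 0.
  under eq_bigr do rewrite scalerBl.
  by rewrite sumrB -xc -xd subrr.
by rewrite dJ // subr0.
Qed.

Lemma rep_face_cone d x : rep_face d x -> cone (below d) (p - x).
Proof.
move: x; apply: hull_sub => [_ [u du <-]|x y t t0 t1 xd yd] /=.
  apply: cone_span_cone; first exact/dominant_cone/p_dominant.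
  by rewrite -opprB -scaleN1r; apply/spanZ/act_span.
have -> : p - (t *: x + (1 - t) *: y) = t *: (p - x) + (1 - t) *: (p - y).
  by apply/rowP => i; rewrite !mxE; ring.
by apply: coneD; apply: coneZ; rewrite // ?subr_ge0 ltW.
Qed.

Lemma rep_face_span d x y : rep_face d x -> rep_face d y ->
  span (below d) (x - y).
Proof.
move=> dx dy; have -> : x - y = (p - y) - (p - x).
  by rewrite opprB [RHS]addrC subrKA.
by apply: spanB; apply/cone_span/rep_face_cone.
Qed.

Lemma rep_face_above0 d x i : rep_face d x -> above d i -> dot x (e i) = 0.
Proof.
move=> /rep_face_cone[c [_ cd] px] di.
rewrite -(subKr p x) px dotBl p_perp; last exact: leq_ltn_trans di.
rewrite dot_suml big1 ?subr0 // => j _; rewrite dotZl.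
have [jd|/cd ->] := boolP (below d j); last by rewrite mul0r.
by rewrite e_far ?mulr0 //; apply: leq_ltn_trans di.
Qed.

Lemma rep_face_ge0 d x (i : 'I_n) :
  rep_face d x -> (d <= i)%N -> 0 <= dot x (e i).
Proof.
move=> /rep_face_cone[c [c0 cd] px] di.
rewrite -(subKr p x) px dotBl subr_ge0 (le_trans _ (p_dominant i)) //.
rewrite dot_suml sumr_le0 // => j _; rewrite dotZl.
have [jd|/cd ->] := boolP (below d j); last by rewrite mul0r.
rewrite mulr_ge0_le0 // e_dot_le0 //; apply: contraTneq jd => ->.
by rewrite /below -leqNgt.
Qed.

Lemma rep_face_stable d u x :
  all (below d) u -> rep_face d x -> rep_face d (act u x).
Proof.
move=> du; apply: hull_act => _ [v dv <-]; exists (u ++ v); last exact: act_cat.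
by rewrite /= all_cat du.
Qed.

Lemma rep_face_fixed d u x : all (above d) u -> rep_face d x -> act u x = x.
Proof.
move=> du dx; apply: act_fix => i /(allP du) di.
by rewrite dotC (rep_face_above0 dx).
Qed.

(** Moving the seed by the reflections 0, 1, ..., d - 1 in turn keeps its
    product with the next root positive, because neighbouring roots form an
    obtuse angle. *)
Lemma vertex_off_wall d (i : 'I_n) : i = d :> nat ->
  exists2 x, vertices d x & 0 < dot x (e i).
Proof.
elim: d i => [|d IHd] i i_d.
  by exists p; [exists [::]|apply: p_gt0].
have d_n : (d < n)%N by rewrite (leq_trans _ (ltn_ord i)) // i_d.
pose j := Ordinal d_n; have [_ [u du <-] ux_gt0] := IHd j erefl.
exists (act (j :: u) p).
  exists (j :: u) => //=; rewrite /below /= ltnSn /=.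
  by apply: sub_all du => k kd; apply: ltnW.
have up0 : dot (act u p) (e i) = 0.
  apply: (@rep_face_above0 d); first by apply: sub_hull; exists u.
  by rewrite /above i_d.
rewrite act_cons reflE dotBl up0 dotZl sub0r oppr_gt0.
by rewrite pmulr_rlt0 ?e_near // dotC mulr_gt0.
Qed.

(** The witnesses are the ends of an edge of the polytope parallel to e i. *)
Lemma root_of_edge d (i : 'I_n) : (i < d)%N ->
  exists x y (a : R), [/\ vertices d x, vertices d y & e i = a *: (x - y)].
Proof.
move=> i_d; have [_ [u iu <-] u_gt0] := @vertex_off_wall i i erefl.
exists (act u p), (act (i :: u) p), (2 * dot (e i) (act u p))^-1; split.
- by apply: (vertices_sub (ltnW i_d)); exists u.
- exists (i :: u) => //=; rewrite /below i_d /=.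
  by apply: sub_all iu => j ji; apply: ltn_trans i_d.
rewrite act_cons reflE subKr scalerA mulVf ?scale1r //.
by rewrite dotC mulf_neq0 // ?pnatr_eq0 // gt_eqF.
Qed.

(** The sum of the vertices of the representative k-face is on the ray of a
    fundamental weight: it is orthogonal to the roots below k because their
    reflections permute the vertices, and to the roots above k because these
    are orthogonal to every vertex. It exposes the face, and its stabilizer is
    known by [dominant_stab]. *)
Lemma rep_face_center (k : 'I_n) : exists L : seq 'rV[R]_n,
  [/\ forall x, x \in L -> vertices k x,
     dominant (\sum_(x <- L) x) &
     forall i, (dot (\sum_(x <- L) x) (e i) == 0) = (i != k)].
Proof.
have /finite_seqP[s vs] := finite_orbit [set u | all (below k) u] p.
pose L := undup s; have memL x : (x \in L) = (x \in s) by rewrite mem_undup.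
have Lv x : x \in L -> vertices k x by rewrite memL /vertices vs.
have Lz i : i != k -> dot (\sum_(x <- L) x) (e i) = 0.
  rewrite neq_ltn => /orP[ik|ki]; last first.
    rewrite dot_suml big_seq big1 // => x /Lv kx.
    by apply: (@rep_face_above0 k) => //; apply: sub_hull.
  have zi : refl (e i) (\sum_(x <- L) x) = \sum_(x <- L) x.
    have -> : refl (e i) (\sum_(x <- L) x) = \sum_(x <- map (refl (e i)) L) x.
      by rewrite big_map -(act_sum [:: i]).
    apply/perm_big/uniq_perm; rewrite ?undup_uniq //.
      by rewrite (map_inj_uniq (inv_inj (reflK i))) undup_uniq.
    have sub x : x \in L -> refl (e i) x \in L.
      move=> /Lv[u ku <-]; rewrite memL.
      suff : vertices k (act (i :: u) p) by rewrite /vertices vs.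
      by exists (i :: u) => //=; rewrite /below ik.
    move=> x; apply/mapP/idP => [[y Ly ->]|Lx]; first exact: sub.
    by exists (refl (e i) x); [apply: sub|rewrite reflK].
  have : dot (refl (e i) (\sum_(x <- L) x)) (e i) = dot (\sum_(x <- L) x) (e i).
    by rewrite zi.
  rewrite reflE dotBl dotZl e_unit (dotC (e i)); lra.
have z_gt0 : 0 < dot (\sum_(x <- L) x) (e k).
  have [x kx x_gt0] := @vertex_off_wall k k erefl.
  have Lx : x \in L by rewrite memL; move: kx; rewrite /vertices vs.
  rewrite (big_rem x) //= dotDl ltr_wpDr // dot_suml big_seq sumr_ge0 // => y.
  move=> /mem_rem/Lv ky; apply: (@rep_face_ge0 k) => //; exact: sub_hull.
exists L; split=> // i; have [->|/Lz ->] := eqVneq i k; rewrite ?eqxx ?lexx //.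
  exact: ltW.
exact: gt_eqF.
Qed.

Let W : set ('rV[R]_n -> 'rV[R]_n) := [set act u | u in [set: seq 'I_n]].
Let P : set 'rV[R]_n := orbit_polytope W p.

Lemma polytope_act u x : P x -> P (act u x).
Proof.
apply: hull_act => _ [_ [v _ <-] <-].
by exists (act (u ++ v)); [exists (u ++ v)|rewrite act_cat].
Qed.

Lemma rep_face_polytope d : rep_face d `<=` P.
Proof.
apply: hull_sub => [_ [u _ <-]|x y t]; last exact: hull_conv.
by apply: sub_hull; exists (act u) => //; exists u.
Qed.

(** The reflections on the far side of node k fix every vertex of the k-face. *)
Lemma act_vertices (k : 'I_n) u :
  all (fun i => i != k) u -> vertices k (act u p).
Proof.
elim: u => [_|i u IHu]; first by exists [::].
rewrite act_cons [all _ _]/= => /andP[]; rewrite neq_ltn => ik /IHu[v kv vu].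
case/orP: ik => [ik|ki].
  by exists (i :: v); rewrite /= ?kv ?andbT // vu.
rewrite -vu refl_fix; first by exists v.
by rewrite dotC (@rep_face_above0 k) //; apply: sub_hull; exists v.
Qed.

(** The face is exposed by its center. *)
Lemma rep_face_is_face (k : 'I_n) : is_face P (rep_face k).
Proof.
have [L [Lk]] := rep_face_center k; set z := \sum_(x <- L) x => z_dom z0.
have P_le x : P x -> dot z x <= dot z p.
  move: x; apply: hull_sub => [_ [_ [u _ <-] <-] /=|x y t t0 t1 /= zx zy].
    rewrite -subr_ge0 -dotBr.
    have [c [c0 _] ->] := dominant_cone u p_dominant.
    by rewrite dot_sumr sumr_ge0 // => i _; rewrite dotZr mulr_ge0.
  by rewrite dotDr !dotZr; nra.
have face_eq x : rep_face k x -> dot z x = dot z p.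
  move=> /rep_face_cone[c [_ ck] px]; rewrite -[x](subKr p) px dotBr.
  rewrite dot_sumr big1 ?subr0 // => i _; rewrite dotZr.
  have [ik|/ck ->] := boolP (below k i); last by rewrite mul0r.
  suff /eqP -> : dot z (e i) == 0 by rewrite mulr0.
  by rewrite z0 neq_ltn; apply/orP; left.
exists z, (dot z p); split=> //; apply/seteqP; split=> [x kx|x [Px zx]].
  by split; [apply: rep_face_polytope kx|apply: face_eq].
(* Unlike the wanted implication, this disjunction is a convex condition. *)
have : dot z x < dot z p \/ rep_face k x.
  move: x Px {zx}; apply: hull_sub => [_ [_ [u _ <-] <-]|x y t t0 t1 xP yP].
    have : dot z (act u p) <= dot z p.
      by apply: P_le; apply: sub_hull; exists (act u) => //; exists u.
    rewrite le_eqVlt => /orP[/eqP zu|]; [right|by left].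
    have [v vz ->] := dominant_exposed z_dom p_dominant zu.
    by apply: sub_hull; apply: act_vertices; rewrite -(eq_all z0).
  have leP (v : 'rV[R]_n) :
      dot z v < dot z p \/ rep_face k v -> dot z v <= dot z p.
    by case=> [/ltW|/face_eq ->].
  have := leP _ xP; have := leP _ yP.
  case: xP => [zx|kx]; [|case: yP => [zy|ky]].
  - by left; rewrite dotDr !dotZr; nra.
  - by left; rewrite dotDr !dotZr; nra.
  - by right; apply: hull_conv.
by case=> //; rewrite zx ltxx.
Qed.

(** The differences of points of the face span the first d roots, by
    [rep_face_span] and [root_of_edge]. *)
Lemma rep_face_dim d u : (d <= n)%N ->
  has_affine_dim d [set act u x | x in rep_face d].
Proof.
move=> d_n; split.
  by exists (act u p); exists p => //; apply: sub_hull; exists [::].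
pose X := [tuple act u (e (widen_ord d_n i)) | i < d].
have spanX x : span (below d) x -> act u x \in <<X>>%VS.
  case=> c cd ->; rewrite act_sum memv_suml // => i _; rewrite actZ.
  have [id|/cd ->] := boolP (below d i); last by rewrite scale0r mem0v.
  apply/memvZ/memv_span; apply/mapP; exists (Ordinal id); first exact: mem_enum.
  by congr (act u (e _)); apply: val_inj.
exists <<X>>%VS; split.
- move=> _ _ [x dx <-] [y dy <-]; rewrite -actB; apply: spanX.
  exact: rep_face_span.
- move=> V dV; apply/span_subvP => _ /mapP[i _ ->].
  have [x [y [a [dx dy ->]]]] := @root_of_edge d (widen_ord d_n i) (ltn_ord i).
  rewrite actZ actB memvZ //; apply: dV; [exists x|exists y] => //;
    exact: sub_hull.
suff /eqP -> : free X by rewrite size_tuple.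
apply/freeP => c; under eq_bigr do rewrite -tnth_nth tnth_mktuple -actZ.
rewrite -act_sum -[RHS](act0 u) => /act_inj c_sum i.
pose C (j : 'I_n) : R := if insub (val j) is Some i then c i else 0.
have CE j : C (widen_ord d_n j) = c j by rewrite /C /= (valK j).
rewrite -CE; apply: e_indep; rewrite (bigID (fun j : 'I_n => (j < d)%N)) /=.
rewrite (big_ord_narrow d_n) [X in _ + X]big1 => [|j /negbTE jd].
  by rewrite addr0 -[RHS]c_sum; apply: eq_bigr => j _; rewrite CE.
by rewrite /C insubF ?scale0r.
Qed.

Lemma polytope_face (k : 'I_n) u : faces P k [set act u x | x in rep_face k].
Proof.
split; last by apply/rep_face_dim/ltnW.
have [c [b [P_le ->]]] := rep_face_is_face k; exists (act u c), b; split.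
  by move=> x Px; rewrite dot_act_adj; apply: P_le; apply: polytope_act.
apply/seteqP; split=> [_ [x [Px cx] <-]|x [Px cx]] /=.
  by rewrite dot_act; split=> //; apply: polytope_act.
exists (act (rev u) x); last exact: act_Krev.
by split; [apply: polytope_act|rewrite /= -dot_act_adj].
Qed.

Lemma refl_comm i j x : dot (e i) (e j) = 0 ->
  refl (e i) (refl (e j) x) = refl (e j) (refl (e i) x).
Proof.
move=> ij; rewrite !reflE !dotBr !dotZr (dotC (e j) (e i)) ij !mulr0 !subr0.
by rewrite addrAC.
Qed.

(** Letters below k and letters above k belong to orthogonal roots, so they
    can be sorted. *)
Lemma split_word (k : 'I_n) v : all (fun i => i != k) v ->
  exists b a, [/\ all (above k) b, all (below k) a & act v =1 act (b ++ a)].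
Proof.
elim: v => [|i v IHv]; first by exists [::], [::].
rewrite [all _ _]/= neq_ltn => /andP[ik /IHv[b [a [bk ak vba]]]].
case/orP: ik => ik; last first.
  exists (i :: b), a; rewrite /= /above ik; split=> // x.
  by rewrite act_cons vba.
exists b, (i :: a); split=> // [|x]; first by rewrite /= ak andbT.
rewrite act_cons vba !act_cat act_cons.
elim: b bk {vba} => // j b IHb /andP[kj /IHb]; rewrite !act_cons => <-.
by apply: refl_comm; apply: e_far; apply: leq_ltn_trans kj.
Qed.

(** * Incidence of faces *)

Section Incidence.
Variables k d : 'I_n.
Hypothesis kd : k.+1 = d.

(** This is the transitivity of the pointwise stabilizer of the k-face on the
    d-faces through it, which are images of the d-face under such w^-1. Choose
    u in the group of the d-face that makes the image under w of the center of
    the k-face nonnegative on the roots below d; on the other roots all points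
    of the d-face are nonnegative. So u w sends the center to a dominant
    vector, which can only be the center itself, and u w splits into an
    element of the group of the k-face and an element fixing the k-face. *)
Lemma incident_face w : (forall x, rep_face k x -> rep_face d (act w x)) ->
  exists2 b, all (above k) b &
    [set act (rev w) x | x in rep_face d] = [set act b x | x in rep_face d].
Proof.
move=> wkd; have [L [Lk]] := rep_face_center k.
set z := \sum_(x <- L) x => z_dom z0.
have [u ud uwz] := make_dominant (below d) (act w z).
have uwz_dom : dominant (act (u ++ w) z).
  move=> i; have [/uwz|] := boolP (below d i); first by rewrite act_cat.
  rewrite /below -leqNgt act_sum dot_suml big_seq => di.
  apply: sumr_ge0 => x /Lk kx; rewrite act_cat.
  by apply: (rep_face_ge0 (rep_face_stable ud (wkd _ (sub_hull kx)))).
have [v vz vuw] := dominant_stab z_dom (dominant_unique z_dom uwz_dom).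
have [|b [a [bk ak vba]]] := @split_word k (rev v).
  by rewrite all_rev; apply: sub_all vz => i; rewrite z0.
have ad : all (below d) a.
  by apply: sub_all ak => i ik; rewrite /below -kd ltnW.
have rw y : act (rev w) y = act b (act a (act u y)).
  rewrite -act_cat -vba; apply: (@act_inj v).
  by rewrite act_Krev vuw act_cat act_Krev.
exists b => //; apply/seteqP; split=> [_ [y dy <-]|_ [y dy <-]].
  exists (act a (act u y)); last by rewrite rw.
  by do 2!apply: rep_face_stable => //.
exists (act (rev u) (act (rev a) y)); last by rewrite rw !act_Krev.
by do 2!(apply: rep_face_stable; rewrite ?all_rev //).
Qed.

(** The displacement w x - x lies in the span of the roots below d and is
    orthogonal to everything that w fixes: to the roots below k, which are
    multiples of differences of vertices of the k-face, and to the center of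
    the k-face, which excludes a component along the root k. *)
Lemma facet_fixed w : (forall x, rep_face k x -> act w x = x) ->
  (forall x, rep_face d x -> rep_face d (act w x)) ->
  forall x, rep_face d x -> act w x = x.
Proof.
move=> wk wd x dx; have [L [Lk]] := rep_face_center k.
set z := \sum_(x <- L) x => _ z0.
have w_perp y : act w y = y -> dot (act w x - x) y = 0.
  by move=> wy; rewrite dotBl -{1}wy dot_act subrr.
have wz : act w z = z.
  by rewrite act_sum; apply: eq_big_seq => y /Lk/sub_hull/wk.
have [c cd vc] := rep_face_span (wd _ dx) dx.
have ck : c k = 0.
  have := w_perp _ wz; rewrite vc dot_suml (bigD1 k) //= big1 ?addr0 => [|i ik].
    by rewrite dotZl dotC => /eqP; rewrite mulf_eq0 z0 eqxx orbF => /eqP.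
  by rewrite dotZl dotC; have := z0 i; rewrite ik => /eqP ->; rewrite mulr0.
apply/eqP; rewrite -subr_eq0; apply/eqP; apply: (@span_perp0 (below k)).
  exists c => // i; rewrite /below -leqNgt leq_eqVlt => /orP[/eqP ki|ki].
    by rewrite -(val_inj ki : k = i).
  by apply: cd; rewrite /below -kd -leqNgt.
move=> i /root_of_edge[y [y' [a [/sub_hull ky /sub_hull ky' ->]]]].
by apply: w_perp; rewrite actZ actB !wk.
Qed.

Lemma pointwise_stabilizer_act h (A : set 'rV[R]_n) :
  pointwise_stabilizer W [set act h x | x in A] =
  [set act h \o s \o act (rev h) | s in pointwise_stabilizer W A].
Proof.
apply/seteqP; split=> [_ [[w _ <-] wA]|_ [_ [[w _ <-] wA] <-]].
  exists (act (rev h ++ w ++ h)); last first.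
    by apply/funext => x; rewrite /= !act_cat !act_Krev.
  split=> [|x Ax]; first by eexists.
  by rewrite !act_cat wA ?act_revK //; exists x.
split=> [|_ [x Ax <-]]; last by rewrite /= act_revK wA.
by exists (h ++ w ++ rev h) => //; apply/funext => x; rewrite !act_cat.
Qed.

Lemma stabilizer_finite A : finite_set (pointwise_stabilizer W A).
Proof. by apply: (sub_finite_set _ W_finite) => w []. Qed.

Lemma ncard_stabilizer_act h (A : set 'rV[R]_n) :
  ncard (pointwise_stabilizer W [set act h x | x in A]) =
  ncard (pointwise_stabilizer W A).
Proof.
rewrite pointwise_stabilizer_act ncard_image //; first exact: stabilizer_finite.
move=> s s' _ _ /funeqP ss'; apply/funext => x.
by have := ss' (act h x); rewrite /= act_revK => /act_inj.
Qed.

(** Orbit counting for the pointwise stabilizer of F': by [incident_face] the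
    d-faces through F' are the images of one of them, and by [facet_fixed] the
    elements with the same image differ by the pointwise stabilizer of that
    face. *)
Theorem incidence_count (F' F : set 'rV[R]_n) : platonic W P ->
  faces P k F' -> faces P d F ->
  finite_set [set G | faces P d G /\ F' `<=` G] /\
  ncard (pointwise_stabilizer W F') =
  (ncard [set G | faces P d G /\ F' `<=` G] *
   ncard (pointwise_stabilizer W F))%N.
Proof.
move=> plat F'face Fface.
have rep_faceP (j : 'I_n) : faces P j (rep_face j).
  by have := polytope_face j [::]; rewrite image_id.
have faceE (j : 'I_n) G :
    faces P j G -> exists w, G = [set act w x | x in rep_face j].
  by move=> /(plat _ (ltn_ord j) _ _ (rep_faceP j))[_ [w _ <-] ->]; exists w.
have [g F'E] := faceE _ _ F'face; have [h FE] := faceE _ _ Fface.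
pose A := pointwise_stabilizer W F'.
pose Fg := [set act g x | x in rep_face d].
have finA : finite_set A by apply: stabilizer_finite.
have XE :
    [set G | faces P d G /\ F' `<=` G] = [set [set w x | x in Fg] | w in A].
  apply/seteqP; split=> [G [/faceE[w ->] F'w]|_ [_ [[w _ <-] wF'] <-]]; last first.
    split.
      by rewrite -image_act_cat; apply: polytope_face.
    move=> x F'x; exists x; last exact: wF'.
    move: F'x; rewrite F'E => -[y ky <-]; exists y => //.
    by apply: rep_face_sub ky; rewrite -kd.
  have [|b bk] := @incident_face (rev w ++ g).
    move=> x kx; have /F'w[y dy] : F' (act g x) by rewrite F'E; exists x.
    by rewrite act_cat => <-; rewrite act_revK.
  rewrite rev_cat revK => wb.
  (* The face is g b applied to the representative face, and conjugating b by
     g gives an element that fixes F' pointwise. *)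
  exists (act (g ++ b ++ rev g)).
    split=> [|x]; first by eexists.
    rewrite F'E => -[y ky <-].
    by rewrite !act_cat act_revK (rep_face_fixed bk ky).
  by rewrite !image_act_cat image_act_revK -wb image_act_cat image_act_Krev.
have F'Fg : F' `<=` Fg.
  rewrite F'E => _ [y ky <-]; exists y => //.
  by apply: rep_face_sub ky; rewrite -kd.
split; first by rewrite XE; apply: finite_image.
rewrite XE FE ncard_stabilizer_act -(ncard_stabilizer_act g (rep_face d)) -/Fg.
apply: ncard_fibers => // _ [[w _ <-] wF'].
rewrite -(@ncard_image _ _ (pointwise_stabilizer W Fg) (fun s => act w \o s)).
- congr ncard; apply/seteqP; split; last first.
    move=> _ [_ [[s _ <-] sFg] <-]; split.
      split=> [|x F'x]; last by rewrite /= sFg ?wF' //; apply: F'Fg.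
      by exists (w ++ s) => //; apply/funext => x; rewrite act_cat.
    by apply: eq_imagel => x Fgx /=; rewrite sFg.
  move=> _ [[[v _ <-] vF'] vFg]; exists (act (rev w ++ v)); last first.
    by apply/funext => x; rewrite /= act_cat act_Krev.
  split=> [|_ [y dy <-]]; first by eexists.
  apply: (@act_inj (rev g)); rewrite act_revK -!act_cat.
  apply: facet_fixed dy => {y} y ky.
    have F'gy : F' (act g y) by rewrite F'E; exists y.
    by rewrite !act_cat vF' // -{1}(wF' _ F'gy) !act_revK.
  have : [set act v x | x in Fg] (act v (act g y)).
    by exists (act g y) => //; exists y.
  by rewrite vFg => -[_ [y' dy' <-]]; rewrite !act_cat => <-; rewrite !act_revK.
- exact: stabilizer_finite.
- move=> s s' _ _ /funeqP ss'; apply/funext => x.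
  by have := ss' x; move=> /act_inj.
Qed.

End Incidence.

End Words.

(** * Simple roots of arbitrary lengths *)

Section SimpleRoots.
Context {R : realType} {n : nat}.
Implicit Types (alpha omega : 'I_n -> 'rV[R]_n) (m : 'I_n -> 'I_n -> nat).

Lemma coxeter_group_words alpha (e : 'I_n -> 'rV[R]_n) :
  (forall i, dot (e i) (e i) = 1) -> (forall i, refl (e i) = refl (alpha i)) ->
  coxeter_group alpha = [set act e u | u in [set: seq 'I_n]].
Proof.
move=> e_unit e_alpha; apply/seteqP; split.
  apply: smallest_sub => [|_ [i _ <-]]; last first.
    by exists [:: i] => //; apply/funext => x; rewrite /= e_alpha.
  split.
  - move=> _ [u _ <-]; exists (act e (rev u)); first exact: act_revK.
    exact: act_Krev.
  - by exists [::].
  - move=> _ _ [u _ <-] [v _ <-]; exists (u ++ v) => //.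
    by apply/funext => x; rewrite act_cat.
  - move=> _ g [u _ <-] _ gu; exists (rev u) => //; apply/funext => x.
    by rewrite -{1}(gu x) act_revK.
move=> _ [u _ <-] H [[_ H1 HM _] sH]; elim: u => [|i u IHu]; first exact: H1.
rewrite (_ : act e (i :: u) = refl (alpha i) \o act e u); last first.
  by apply/funext => x; rewrite -e_alpha.
by apply: HM => //; apply: sH; exists i.
Qed.

Lemma simple_roots_indep alpha m : simple_roots alpha m ->
  forall c : 'I_n -> R, \sum_i c i *: alpha i = 0 -> forall i, c i = 0.
Proof.
case=> alpha_free _ _ _ c c_sum.
have alphaE : [seq alpha i | i <- enum 'I_n] = [tuple alpha i | i < n].
  by rewrite -val_ord_tuple.
rewrite alphaE in alpha_free; apply: (freeP alpha_free).
by rewrite -[RHS]c_sum; apply: eq_bigr => i _; rewrite -tnth_nth tnth_mktuple.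
Qed.

Lemma norm2_gt0 alpha m i : simple_roots alpha m -> 0 < norm2 (alpha i).
Proof.
move=> alpha_m; rewrite sqrtr_gt0 lt_def dot_ge0 andbT.
apply/eqP => /dot_eq0 ai0.
have := simple_roots_indep alpha_m (c := fun j => (j == i)%:R).
rewrite (bigD1 i) //= ai0 scaler0 big1 => [|j /negbTE ->]; last first.
  by rewrite scale0r.
by move=> /(_ (addr0 _) i)/eqP; rewrite eqxx oner_eq0.
Qed.

(** * Reversing the numbering of the nodes *)

Lemma simple_roots_rev alpha m : simple_roots alpha m ->
  simple_roots (alpha \o @rev_ord n) (fun i j => m (rev_ord i) (rev_ord j)).
Proof.
case=> alpha_free m1 m2 alpha_dot.
split=> // [|i j ij|i j]; last exact: alpha_dot.
  rewrite (map_comp alpha) (perm_free (Y := [seq alpha i | i <- enum 'I_n])) //.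
  apply/perm_map/uniq_perm; rewrite ?enum_uniq //.
    by rewrite (map_inj_uniq rev_ord_inj) enum_uniq.
  move=> i; rewrite mem_enum; apply/mapP.
  exists (rev_ord i); rewrite ?mem_enum //.
  by rewrite rev_ordK.
by rewrite m2 // (inj_eq rev_ord_inj).
Qed.

Lemma line_diagram_rev m : line_diagram m ->
  line_diagram (fun i j => m (rev_ord i) (rev_ord j)).
Proof.
move=> m_line i j; rewrite m_line /=; have := ltn_ord i; have := ltn_ord j.
by move=> ? ?; apply/idP/idP; lia.
Qed.

Lemma fundamental_weights_rev alpha omega : fundamental_weights alpha omega ->
  fundamental_weights (alpha \o @rev_ord n) (omega \o @rev_ord n).
Proof. by move=> dual k j; rewrite dual (inj_eq rev_ord_inj). Qed.

Lemma coxeter_group_rev alpha :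
  coxeter_group (alpha \o @rev_ord n) = coxeter_group alpha.
Proof.
congr smallest; apply/seteqP; split=> _ [i _ <-]; exists (rev_ord i) => //.
by rewrite /= rev_ordK.
Qed.

(** Scaling the roots to unit length changes no reflection, and the sum of the
    fundamental weights is a vector positive on all of them. *)
Lemma incidence_count_first alpha omega m (k0 k d : 'I_n) (F' F : set 'rV[R]_n) :
  simple_roots alpha m -> line_diagram m -> finite_set (coxeter_group alpha) ->
  fundamental_weights alpha omega -> k0 = 0 :> nat -> k.+1 = d ->
  let W := coxeter_group alpha in
  let P := orbit_polytope W (omega k0) in
  platonic W P -> faces P k F' -> faces P d F ->
  finite_set [set G | faces P d G /\ F' `<=` G] /\
  ncard (pointwise_stabilizer W F') =
  (ncard [set G | faces P d G /\ F' `<=` G] *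
   ncard (pointwise_stabilizer W F))%N.
Proof.
move=> alpha_m m_line W_fin dual k00 kd /=.
have [_ m1 m2 alpha_dot] := alpha_m.
pose N i := norm2 (alpha i); pose e i := (N i)^-1 *: alpha i.
have N0 i : 0 < N i by apply: norm2_gt0 alpha_m.
have N0' i : N i != 0 by rewrite gt_eqF.
have dotE i j : dot (e i) (e j) = - cos (pi / (m i j)%:R).
  by rewrite dotZl dotZr alpha_dot -/(N i) -/(N j); field; rewrite !N0'.
have e_unit i : dot (e i) (e i) = 1 by rewrite dotE m1 divr1 cospi opprK.
have e_alpha i : refl (e i) = refl (alpha i) by rewrite refl_scale ?invr_neq0.
have WE := coxeter_group_words e_unit e_alpha; rewrite WE in W_fin *.
have e_indep c : \sum_i c i *: e i = 0 -> forall i, c i = 0.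
  under eq_bigr do rewrite scalerA.
  move=> /(simple_roots_indep alpha_m) c0 i; have /eqP := c0 i.
  by rewrite mulf_eq0 invr_eq0 (negbTE (N0' i)) orbF => /eqP.
have omegaE j i : dot (omega j) (e i) = (j == i)%:R * (N i / 2).
  rewrite -dual alpha_dot m1 divr1 cospi dotZr -/(N i).
  by field; rewrite N0'.
have m_near (i j : 'I_n) : i.+1 = j -> (2 < m i j)%N.
  by move=> /eqP ij; rewrite m_line ij.
have e_dot i j : i != j -> dot (e i) (e j) = - cos (pi / (m i j)%:R) by [].
have rho_gt0 i : 0 < dot (\sum_j omega j) (e i).
  rewrite dot_suml (bigD1 i) //= big1 ?addr0 => [|j /negbTE ji].
    by rewrite omegaE eqxx mul1r divr_gt0.
  by rewrite omegaE ji mul0r.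
have e_far (i j : 'I_n) : (i.+1 < j)%N -> dot (e i) (e j) = 0.
  move=> ij; rewrite dotE; suff -> : m i j = 2%N by rewrite cos_pihalf oppr0.
  apply/eqP; rewrite eqn_leq m2; last by rewrite neq_ltn (ltnW ij).
  rewrite andbT leqNgt m_line; lia.
have e_near (i j : 'I_n) : i.+1 = j -> dot (e i) (e j) < 0.
  move=> /m_near m3; rewrite dotE oppr_lt0; apply: cos_gt0_pihalf.
  have pi0 := pi_gt0 R.
  have m0 : 0 < (m i j)%:R :> R by rewrite ltr0n ltnW // ltnW.
  apply/andP; split.
    by rewrite (@lt_trans _ _ 0) ?oppr_lt0 ?divr_gt0.
  by rewrite ltr_pM2l // ltf_pV2 ?posrE // ltr_nat.
have p_perp (i : 'I_n) : (0 < i)%N -> dot (omega k0) (e i) = 0.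
  move=> i0; rewrite omegaE (_ : k0 == i = false) ?mul0r //.
  by apply: contraTF i0 => /eqP <-; rewrite k00.
have p_gt0 (i : 'I_n) : i = 0 :> nat -> 0 < dot (omega k0) (e i).
  move=> i0; rewrite omegaE (_ : k0 == i) ?mul1r ?divr_gt0 //.
  by apply/eqP/val_inj; rewrite /= k00.
exact: (incidence_count e_unit e_indep m2 e_dot W_fin rho_gt0 e_far e_near
  p_perp p_gt0 kd).
Qed.

End SimpleRoots.

(* Nodes are numbered from 0: the extreme nodes 1 and n are 0 and n.-1. *)
Theorem proposition3p1 (R : realType) (n : nat) (n_ge3 : (3 <= n)%N)
    (alpha omega : 'I_n -> 'rV[R]_n) (m : 'I_n -> 'I_n -> nat)
    (alpha_simple : simple_roots alpha m)
    (m_line : line_diagram m)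
    (W_finite : finite_set (coxeter_group alpha))
    (omega_dual : fundamental_weights alpha omega)
    (k : 'I_n) (k_extreme : (k = 0 :> nat)%N \/ (k = n.-1 :> nat)%N)
    (P : set 'rV[R]_n)
    (P_generated : P = orbit_polytope (coxeter_group alpha) (omega k))
    (P_platonic : platonic (coxeter_group alpha) P)
    (d : nat) (d_ge1 : (1 <= d)%N) (d_le : (d <= n - 2)%N)
    (f_pred f : set 'rV[R]_n)
    (f_pred_face : faces P d.-1 f_pred) (f_face : faces P d f) :
  finite_set [set F | faces P d F /\ f_pred `<=` F] /\
  (ncard [set F | faces P d F /\ f_pred `<=` F])%:R
    = (ncard (pointwise_stabilizer (coxeter_group alpha) f_pred))%:R
      / (ncard (pointwise_stabilizer (coxeter_group alpha) f))%:R :> rat.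
Proof.
have d_n : (d < n)%N by lia.
have d1_n : (d.-1 < n)%N by lia.
have count : finite_set [set F | faces P d F /\ f_pred `<=` F] /\
    ncard (pointwise_stabilizer (coxeter_group alpha) f_pred) =
    (ncard [set F | faces P d F /\ f_pred `<=` F] *
     ncard (pointwise_stabilizer (coxeter_group alpha) f))%N.
  have dS : (Ordinal d1_n).+1 = Ordinal d_n by rewrite /= prednK.
  rewrite {}P_generated in P_platonic f_pred_face f_face *.
  case: k_extreme => [k0|kn].
    by apply: (incidence_count_first alpha_simple m_line W_finite omega_dual
      k0 dS).
  rewrite -coxeter_group_rev in W_finite P_platonic f_pred_face f_face *.
  rewrite -(rev_ordK k) in P_platonic f_pred_face f_face *.
  have k0 : rev_ord k = 0 :> nat by rewrite /= kn; lia.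
  exact: (incidence_count_first (simple_roots_rev alpha_simple)
    (line_diagram_rev m_line) W_finite (fundamental_weights_rev omega_dual)
    k0 dS).
case: count => fin_faces ->; split=> //; rewrite natrM mulfK // pnatr_eq0 -lt0n.
have f_id : pointwise_stabilizer (coxeter_group alpha) f id.
  by split=> // H [[_ H1 _ _] _]; apply: H1.
apply: (ncard_gt0 _ f_id).
by apply: sub_finite_set W_finite => w [].
Qed.
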